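(* Let $1\le k\le n$ and let $t$ be an integer with $0\le t\le (k-1)(n-k)$ (the number of $-1$ entries of $F_n^k$). Then there exist an $n\times n$ ASM $A_k$ with exactly $t$ entries equal to $-1$ and $n\times n$ permutation matrices $P_1,\ldots,P_{k-1},P_{k+1},\ldots,P_n$ such that $[P_1,\ldots,P_{k-1},A_k,P_{k+1},\ldots,P_n]$ is an $n\times n\times n$ ASHM.
   Context: An $n\times n$ alternating sign matrix (ASM) is an $n\times n$ matrix with entries in $\{0,1,-1\}$ such that in every row and column the nonzeros alternate in sign, beginning and ending with $+1$. An $n\times n\times n$ hypermatrix $[A_1,\ldots,A_n]$ ($A_s$ the horizontal planes) is an ASHM if all entries are in $\{0,\pm1\}$ and in every line (obtained by fixing two of the three indices) the nonzeros alternate in sign beginning and ending with $+1$. For $1\le k\le n$, $F_n^k=[f_{ij}]$ is the $n\times n$ matrix with $f_{ij}=(-1)^{i+j+k+1}$ if $k+1\le i+j\le 2n+1-k$ and $|i-j|\le k-1$, and $f_{ij}=0$ otherwise; it is an ASM with $(k-1)(n-k)$ entries equal to $-1$. *)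

(* Defs.v *)
From HB Require Import structures.
From mathcomp Require Import all_boot all_order all_algebra all_fingroup.
Set Implicit Arguments. Unset Strict Implicit. Unset Printing Implicit Defensive.
Import Order.TTheory GRing.Theory Num.Theory.
Local Open Scope ring_scope.

(* A finite sequence of integers is alternating-sign: all entries lie in
   {0,1,-1} and the nonzero entries read 1,-1,1,...,-1,1 (alternate in sign,
   begin and end with +1; in particular at least one nonzero entry). *)
Definition alt_sign_seq (s : seq int) : bool :=
  let nz := [seq x <- s | x != 0] in
  [&& all (fun x => x \in [:: 0; 1; -1]) s,
      nz == [seq (-1) ^+ i | i <- iota 0 (size nz)] &
      odd (size nz)].

Definition line (n : nat) (f : 'I_n -> int) : seq int :=
  [seq f i | i <- enum 'I_n].

Definition alt_line (n : nat) (f : 'I_n -> int) : bool := alt_sign_seq (line f).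

Definition is_ASM (n : nat) (A : 'M[int]_n) : Prop :=
  (forall i : 'I_n, alt_line (fun j => A i j)) /\
  (forall j : 'I_n, alt_line (fun i => A i j)).

(* Hypermatrix [A_1,...,A_n] given by its horizontal planes H s; entry
   (s,i,j) is H s i j.  ASHM: every line (fix two of the three indices)
   is alternating-sign. *)
Definition is_ASHM (n : nat) (H : 'I_n -> 'M[int]_n) : Prop :=
  (forall i j : 'I_n, alt_line (fun s => H s i j)) /\
  (forall s i : 'I_n, alt_line (fun j => H s i j)) /\
  (forall s j : 'I_n, alt_line (fun i => H s i j)).

Definition num_neg (n : nat) (A : 'M[int]_n) : nat :=
  #|[set ij : 'I_n * 'I_n | A ij.1 ij.2 == -1]|.

(* Main.v *)
Require Import Defs.
From HB Require Import structures.
From mathcomp Require Import all_boot all_order all_algebra all_fingroup.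
From mathcomp Require Import zify.
Import GRing.Theory.
Local Open Scope ring_scope.

(** Put [m = k - 1] and [l = n - k].  A line through the planes at [(i, j)] is
    alternating iff [U i j + A i j + L i j = 1] with [U i j], [L i j] in {0, 1},
    where [U] and [L] are the sums of the permutation planes below and above [A].
    By Hall's theorem every 0/1 matrix with all line sums [d] is a sum of [d]
    permutation matrices, so it is enough to find an ASM [A] and a 0/1 matrix [U]
    with line sums [m] such that [U] is 1 where [A] is -1 and 0 where [A] is 1:
    then [L = J - U - A] is a 0/1 matrix with line sums [l].

    For [A = F_n^k], [U] consists of the -1 entries and of the upper left and lower
    right corners outside the rotated rectangle supporting [F_n^k].  The same [U]
    still works after erasing up to [l] of the -1 entries along one edge of that
    rectangle, which covers [(m - 1) l <= t <= m l].  For smaller [t], replace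
    [(A, U)] for [m - 1] by the direct sum of [A] and 1, together with [U]
    extended by the subdiagonal [i = j + m] (on which [A] and [U] vanish) and
    suitable last row and column. *)

Set Implicit Arguments.
Unset Strict Implicit.
Unset Printing Implicit Defensive.

(** * Hall's theorem and sums of permutations *)

(** Induction on a bound for [#|A|]. If some nonempty proper subset [X] is tight, match [X] inside
    its neighbourhood [NX] and [A :\: X] outside it; Hall's condition for [Y] outside [NX] is the
    one for [X :|: Y] minus the tight equality. Otherwise every nonempty proper subset has a spare
    neighbour, so any [x0] may take any neighbour [y0]. *)
Lemma Hall_on (T : finType) (N : T -> {set T}) (A : {set T}) :
  (forall X : {set T}, X \subset A -> #|X| <= #|\bigcup_(x in X) N x|)%N ->
  exists2 f : T -> T, {in A &, injective f} & {in A, forall x, f x \in N x}.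
Proof.
elim: {A}#|A| {-2}A (leqnn #|A|) N => [|c IH] A.
  rewrite leqn0 cards_eq0 => /eqP -> N _.
  by exists id => x; rewrite inE.
move=> Ac N H.
have [->|[x0 x0A]] := set_0Vmem A; first by exists id => x; rewrite inE.
case: (boolP [exists X : {set T},
   [&& X != set0, X \proper A & #|X| == #|\bigcup_(x in X) N x|]]) => [|noX].
  case/existsP => X /and3P[X0 XA /eqP cX].
  have sXA := proper_sub XA.
  have [||f1 f1i f1N] := IH X _ N.
  - by rewrite -ltnS; apply: leq_trans Ac; apply: proper_card.
  - by move=> Y YX; apply: H; apply: subset_trans YX sXA.
  set NX := \bigcup_(x in X) N x.
  have [||f2 f2i f2N] := IH (A :\: X) _ (fun x => N x :\: NX).
  - have := cardsID X A; rewrite (setIidPr sXA) => eA.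
    have : (0 < #|X|)%N by rewrite card_gt0.
    by lia.
  - move=> Y; rewrite subsetD => /andP[YA dYX].
    have := H (X :|: Y); rewrite subUset sXA YA => /(_ isT).
    rewrite cardsU disjoint_setI0 1?disjoint_sym // cards0 subn0 bigcup_setU -/NX.
    have -> : NX :|: \bigcup_(x in Y) N x = NX :|: \bigcup_(x in Y) (N x :\: NX).
      apply/setP => y; rewrite !inE; case: (boolP (y \in NX)) => //= yN.
      apply/bigcupP/bigcupP => -[x xY]; first by exists x; rewrite // inE yN.
      by rewrite inE yN => ?; exists x.
    by have := cardsU NX (\bigcup_(x in Y) (N x :\: NX)); move: cX; rewrite -/NX; lia.
  have f1X x : x \in X -> f1 x \in NX by move=> xX; apply/bigcupP; exists x => //; apply: f1N.
  have f2X x : x \in A -> x \notin X -> f2 x \notin NX.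
    by move=> xA xX; have := f2N x; rewrite !inE xA xX => /(_ isT)/andP[].
  exists (fun x => if x \in X then f1 x else f2 x).
    move=> x y xA yA; case: ifPn => xX; case: ifPn => yX.
    - exact: f1i.
    - by move=> e; have := f2X y yA yX; rewrite -e f1X.
    - by move=> e; have := f2X x xA xX; rewrite e f1X.
    - by apply: f2i; rewrite inE ?xX ?yX.
  move=> x xA; case: ifPn => xX; first exact: f1N.
  by have := f2N x; rewrite !inE xA xX => /(_ isT)/andP[].
have [y0 y0N] : exists y, y \in N x0.
  have := H [set x0]; rewrite sub1set x0A cards1 big_set1 => /(_ isT).
  by case/card_gt0P => y; exists y.
have [||f fi fN] := IH (A :\ x0) _ (fun x => N x :\ y0).
- by move: Ac; rewrite (cardsD1 x0) x0A.
- move=> Y YA.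
  have [->|Y0] := eqVneq Y set0; first by rewrite cards0.
  have YpA : Y \proper A.
    by apply: sub_proper_trans YA _; rewrite properD1.
  have := H Y (proper_sub YpA).
  move/existsPn/(_ Y): noX; rewrite Y0 YpA /= => ne le.
  have -> : \bigcup_(x in Y) (N x :\ y0) = (\bigcup_(x in Y) N x) :\ y0.
    apply/setP => y; rewrite !inE; apply/bigcupP/andP => [[x xY]|[yy /bigcupP[x xY yN]]].
      by rewrite !inE => /andP[-> yN]; split=> //; apply/bigcupP; exists x.
    by exists x; rewrite // !inE yy.
  have := cardsD1 y0 (\bigcup_(x in Y) N x).
  by move: ne le; case: (y0 \in _); lia.
have fy x : x \in A -> x != x0 -> f x != y0.
  by move=> xA xx; have := fN x; rewrite !inE xA xx => /(_ isT)/andP[].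
exists (fun x => if x == x0 then y0 else f x).
  move=> x y xA yA; case: eqP => [->|/eqP xx]; case: eqP => [->|/eqP yx] //.
  - by move=> e; have := fy y yA yx; rewrite -e eqxx.
  - by move=> e; have := fy x xA xx; rewrite e eqxx.
  - by apply: fi; rewrite !inE ?xx ?yx.
move=> x xA; case: eqP => [->//|/eqP xx].
by have := fN x; rewrite !inE xA xx => /(_ isT)/andP[].
Qed.

(** Hall's condition by double counting: the [d.+1] edges at each point of [X] all end in [NX],
    whose points receive [d.+1] edges each. *)
Lemma regular_has_perm (T : finType) (e : rel T) (d : nat) :
  (forall i, \sum_j e i j = d.+1)%N -> (forall j, \sum_i e i j = d.+1)%N ->
  exists p : {perm T}, forall i, e i (p i).
Proof.
move=> er ec.
have [|f fi fN] := @Hall_on T (fun i => [set j | e i j]) setT.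
  move=> X _; set NX := \bigcup_(x in X) _.
  rewrite -(leq_pmul2l (ltn0Sn d)) mulnC [leqRHS]mulnC -!sum_nat_const.
  rewrite -(eq_bigr _ (fun i _ => er i)) -(eq_bigr _ (fun j _ => ec j)).
  rewrite [leqRHS]exchange_big /= [leqRHS](bigID (mem X)) /=.
  apply: leq_trans (leq_addr _ _); apply: leq_sum => i iX.
  rewrite (bigID (mem NX)) /= [X in (_ + X)%N]big1 ?addn0 // => j jN.
  apply/eqP; rewrite eqb0; apply: contra jN => eij.
  by apply/bigcupP; exists i => //; rewrite inE.
have fj : injective f by move=> x y; apply: fi; rewrite inE.
by exists (perm fj) => i; rewrite permE; have := fN i; rewrite !inE; apply.
Qed.

Lemma regular_perm_decomp (T : finType) (e : rel T) (d : nat) :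
  (forall i, \sum_j e i j = d)%N -> (forall j, \sum_i e i j = d)%N ->
  exists p : nat -> {perm T},
    forall i j, (\sum_(s < d) (p s i == j) = e i j)%N.
Proof.
elim: d e => [|d IH] e er ec.
  exists (fun _ => 1%g) => i j; rewrite big_ord0.
  by have /eqP := er i; rewrite sum_nat_eq0 => /forallP/(_ j)/eqP ->.
have [q qe] := regular_has_perm er ec.
pose e' i j := e i j && (q i != j).
have eE i j : (e i j = e' i j + (q i == j) :> nat)%N.
  by rewrite /e'; case: (altP (q i =P j)) => [<-|_]; rewrite ?qe ?andbT ?addn0.
have [||p pE] := IH e'.
- move=> i; have := er i; rewrite (eq_bigr _ (fun j _ => eE i j)) big_split /=.
  rewrite [X in (_ + X)%N](bigD1 (q i)) //= eqxx [X in (true + X)%N]big1 ?addn0; last first.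
    by move=> j /negbTE; rewrite eq_sym => ->.
  by rewrite addn1 => -[].
- move=> j; have := ec j; rewrite (eq_bigr _ (fun i _ => eE i j)) big_split /=.
  rewrite [X in (_ + X)%N](bigD1 (q^-1 j)%g) //= permKV eqxx [X in (true + X)%N]big1 ?addn0; last first.
    by move=> i; rewrite -(inj_eq (@perm_inj _ q)) permKV => /negbTE ->.
  by rewrite addn1 => -[].
exists (fun s => if s == d then q else p s) => i j.
rewrite big_ord_recr /= eqxx eE -pE; congr addn.
by apply: eq_bigr => s _; rewrite ltn_eqF.
Qed.

(** * Alternating lines and their prefix sums *)

(* The partial sums of an alternating line are 0 or 1; [R] records them. *)
Definition alternating n (f : nat -> int) :=
  exists R : nat -> bool, [/\ R 0%N = false, R n = true &
    forall j, (j < n)%N -> f j = (R j.+1)%:Z - (R j)%:Z].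

(** The start [a] is arbitrary so that the induction can shift it. The offset [R a] in the exponent
    reflects that from prefix sum 1 the next nonzero entry is -1. *)
Lemma alt_sign_prefix (R : nat -> bool) a n :
  let s := [seq (R i.+1)%:Z - (R i)%:Z | i <- iota a n] in
  let nz := [seq x <- s | x != 0] in
  [/\ all (fun x => x \in [:: 0; 1; -1]) s,
      nz = [seq (-1) ^+ (R a + i) | i <- iota 0 (size nz)] &
      odd (size nz) = R a (+) R (a + n)%N].
Proof.
elim: n a => [|n IH] a /=; first by rewrite addn0 addbb.
have [IH1 IH2 IH3] := IH a.+1.
move: IH1 IH2 IH3; set w := map _ _; rewrite -addSnnS.
move: [seq x <- w | x != 0] => nz -> eqnz oddnz.
have cons_sign b c : nz = [seq (-1) ^+ (b + i) | i <- iota 0 (size nz)] ->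
    (-1) ^+ c = (-1) ^+ b.+1 :> int ->
    (-1) ^+ c :: nz = [seq (-1) ^+ (c + i) | i <- iota 0 (size nz).+1].
  move=> {1}-> ec /=; rewrite addn0 -[1%N]addn0 iotaDl -map_comp; congr cons.
  apply: eq_map => i /=; rewrite !exprD ec exprS.
  by rewrite expr1 mulrACA mulrNN !mul1r.
by move: eqnz oddnz (cons_sign (R a.+1) (R a)); case: (R a); case: (R a.+1) => //= E -> C;
  split=> //; rewrite ?negbK //; apply: (C E).
Qed.

Lemma alternating_alt_line n (f : nat -> int) : alternating n f -> alt_line (fun i : 'I_n => f i).
Proof.
case=> R [R0 Rn fE]; rewrite /alt_line /line /alt_sign_seq.
have -> : [seq f (i : 'I_n) | i <- enum 'I_n] = [seq (R i.+1)%:Z - (R i)%:Z | i <- iota 0 n].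
  rewrite -val_enum_ord -map_comp; apply: eq_map => i /=; exact: fE.
have [-> /eqP e ->] := alt_sign_prefix R 0 n.
by rewrite add0n R0 Rn /= andbT; move: e; rewrite R0.
Qed.

Lemma alternating_sum n f : alternating n f -> \sum_(j < n) f j = 1.
Proof.
case=> R [R0 Rn fE]; rewrite (eq_bigr (fun j : 'I_n => (R j.+1)%:Z - (R j)%:Z)).
  by rewrite -(big_mkord xpredT (fun j => (R j.+1)%:Z - (R j)%:Z)) telescope_sumr // R0 Rn.
by move=> j _; apply: fE.
Qed.

Lemma alternating_partial_sums n (f : nat -> int) :
  (forall p, (p < n)%N -> \sum_(j < p) f j \in [:: 0; 1]) ->
  \sum_(j < n) f j = 1 -> alternating n f.
Proof.
move=> fp fn; have fp' p : (p <= n)%N -> \sum_(j < p) f j \in [:: 0; 1].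
  by rewrite leq_eqVlt => /orP[/eqP ->|/fp//]; rewrite fn.
exists (fun p => \sum_(j < p) f j == 1); split; rewrite ?big_ord0 ?fn //.
move=> j jn; have := fp' _ jn; have := fp' _ (ltnW jn).
rewrite big_ord_recr /= !inE => /orP[]/eqP-> /orP[]/eqP; lia.
Qed.

Lemma alt_line_delta n (i : 'I_n) (f : 'I_n -> int) :
  (forall j, f j = (j == i)%:Z) -> alt_line f.
Proof.
move=> fE.
have -> : alt_line f = alt_line (fun j : 'I_n => (j == i :> nat)%:Z).
  by congr alt_sign_seq; apply: eq_map => j; rewrite fE.
apply: (@alternating_alt_line n (fun j => (j == i :> nat)%:Z)).
exists (fun p => i < p)%N; split=> [||j _]; rewrite ?ltn_ord //.
by lia.
Qed.

(** * From a compatible pair to an ASHM *)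

Definition compatible n m (A : nat -> nat -> int) (U : nat -> nat -> bool) :=
  [/\ forall i, (i < n)%N -> alternating n (A i),
      forall j, (j < n)%N -> alternating n (A^~ j),
      forall i, (i < n)%N -> (\sum_(j < n) U i j = m)%N,
      forall j, (j < n)%N -> (\sum_(i < n) U i j = m)%N &
      forall i j, (i < n)%N -> (j < n)%N -> A i j != 0 -> U i j = (A i j == -1)].

Lemma alternating_entry n f j : alternating n f -> (j < n)%N -> f j \in [:: 0; 1; -1].
Proof. by case=> R [_ _ fE] /fE ->; case: (R _); case: (R _). Qed.

Lemma compatible_ASHM m l A U (n := (m + l).+1) :
  compatible n m A U ->
  exists P : 'I_n -> 'M[int]_n,
    (forall s : 'I_n, s != m :> nat -> is_perm_mx (P s)) /\
    is_ASHM (fun s : 'I_n => if s == m :> nat then \matrix_(i, j) A i j else P s).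
Proof.
case=> Arow Acol Urow Ucol AU.
have [p pU] : exists p : nat -> 'S_n,
    forall i j : 'I_n, (\sum_(s < m) (p s i == j) = U i j)%N.
  apply: (@regular_perm_decomp _ (fun i j : 'I_n => U i j)) => i; first exact: Urow.
  exact: Ucol.
(* By the last clause of [compatible], [1 - U - A] is always 0 or 1, so testing it against 1 loses
   nothing. *)
pose L (i j : 'I_n) := 1 - (U i j)%:Z - A i j == 1.
have LE (i j : 'I_n) : (U i j)%:Z + A i j + (L i j)%:Z = 1.
  have := alternating_entry (Arow i (ltn_ord i)) (ltn_ord j).
  have := AU i j (ltn_ord i) (ltn_ord j).
  by rewrite /L !inE; case: (U i j) => H /or3P[]/eqP E;
    rewrite E in H *; rewrite // ; have := H isT.
have Lsum (F G : 'I_n -> nat) (B : 'I_n -> int) :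
    (\sum_i F i = m)%N -> \sum_i B i = 1 ->
    (forall i, (F i)%:Z + B i + (G i)%:Z = 1) -> (\sum_i G i = l)%N.
  move=> sF sB E; have : \sum_i ((F i)%:Z + B i + (G i)%:Z) = n%:Z.
    by rewrite (eq_bigr _ (fun i _ => E i)) sumr_const card_ord natz.
  rewrite !big_split /= sB -!(big_morph Posz PoszD (erefl (Posz 0))) sF /n; lia.
have [q qL] : exists q : nat -> 'S_n,
    forall i j : 'I_n, (\sum_(s < l) (q s i == j) = L i j)%N.
  apply: (@regular_perm_decomp _ L) => [i|j].
    exact: Lsum (Urow i (ltn_ord i)) (alternating_sum (Arow i (ltn_ord i))) (LE i).
  exact: Lsum (Ucol j (ltn_ord j)) (alternating_sum (Acol j (ltn_ord j))) (LE^~ j).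
(* The value of [Q] at [m] is a dummy: that plane is [A]. *)
pose Q (s : nat) : 'S_n := if (s < m)%N then p s else q (s - m.+1)%N.
exists (fun s => perm_mx (Q s)); split=> [s _|]; first exact: perm_mx_is_perm.
split=> [i j|].
  pose h s : int := if s == m then A i j else (Q s i == j)%:Z.
  have -> : alt_line (fun s : 'I_n => (if s == m :> nat then \matrix_(i, j) A i j
      else perm_mx (Q s)) i j) = alt_line (fun s : 'I_n => h s).
    by congr alt_sign_seq; apply: eq_map => s; rewrite /h; case: ifP; rewrite !mxE ?natz.
  have hp x : (x <= m)%N -> \sum_(s < x) h s = (\sum_(s < x) (p s i == j))%N%:Z.
    move=> xm; rewrite (big_morph Posz PoszD (erefl (Posz 0))); apply: eq_bigr => s _.
    by rewrite /h /Q (leq_trans (ltn_ord s) xm) ltn_eqF // (leq_trans (ltn_ord s) xm).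
  have hq x : (x <= l)%N -> \sum_(s < m.+1 + x) h s =
      (U i j)%:Z + A i j + (\sum_(s < x) (q s i == j))%N%:Z.
    move=> xm; rewrite big_split_ord /= big_ord_recr /= hp // pU /h eqxx; congr (_ + _).
    rewrite (big_morph Posz PoszD (erefl (Posz 0))); apply: eq_bigr => s _ /=.
    by rewrite /Q addSn gtn_eqF ?ltnS ?leq_addr // ltnNge -addSn subDnCA // subnn addn0 ltnW ?ltnS ?leq_addr.
  apply: alternating_alt_line; apply: alternating_partial_sums; last first.
    by rewrite -[n]/(m.+1 + l)%N hq // qL LE.
  have mono (g : nat -> 'S_n) x y : (x <= y)%N ->
     (\sum_(s < x) (g s i == j) <= \sum_(s < y) (g s i == j))%N.
    by move=> xy; rewrite -(subnKC xy) big_split_ord leq_addr.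
  (* A prefix ending before plane [m] sums to between 0 and [U i j]; a longer one to between
     [U i j + A i j], which is [1 - L i j], and 1. *)
  move=> x; have [xm _|mx xn] := leqP x m.
    rewrite hp //; have := mono p _ _ xm; rewrite pU; case: (\sum_(s < x) _)%N (U i j) => [|[|y]] [] //.
  have -> : x = (m.+1 + (x - m.+1))%N by lia.
  have xl : (x - m.+1 <= l)%N by rewrite /n in xn; lia.
  rewrite hq //; have := mono q _ _ xl; rewrite qL; have := LE i j.
  by rewrite !inE; move: (\sum_(s < _) _)%N => y; case: (L i j); lia.
split=> [s i|s j].
  case: (altP (s =P m :> nat)) => _.
    have -> : alt_line (fun j : 'I_n => (\matrix_(i, j) A i j : 'M[int]_n) i j) =
              alt_line (fun j : 'I_n => A i j).
      by congr alt_sign_seq; apply: eq_map => j; rewrite mxE.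
    exact: alternating_alt_line (Arow i (ltn_ord i)).
  by apply: (alt_line_delta (i := Q s i)) => j; rewrite !mxE natz eq_sym.
case: (altP (s =P m :> nat)) => _.
  have -> : alt_line (fun i : 'I_n => (\matrix_(i, j) A i j : 'M[int]_n) i j) =
            alt_line (fun i : 'I_n => A i j).
    by congr alt_sign_seq; apply: eq_map => i; rewrite mxE.
  exact: alternating_alt_line (Acol j (ltn_ord j)).
apply: (alt_line_delta (i := (Q s)^-1%g j)) => i.
by rewrite !mxE natz -[in RHS](inj_eq (@perm_inj _ (Q s))) permKV.
Qed.

(** * Adding one row and one column *)

(** The invariant that keeps the subdiagonal [i = j + m.+1] free for the next extension. *)
Definition vanish_below m n (A : nat -> nat -> int) (U : nat -> nat -> bool) :=
  forall i j, (i < n)%N -> (j + m < i)%N -> A i j = 0 /\ U i j = false.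

Definition count_neg n (A : nat -> nat -> int) : nat :=
  (\sum_(i < n) \sum_(j < n) (A i j == -1)%R)%N.

Definition ext_ASM n (A : nat -> nat -> int) (i j : nat) : int :=
  if (i < n)%N && (j < n)%N then A i j else (i == j)%:Z.

(** The subdiagonal meets exactly the rows [i > m] and the columns [j < l] of the old block. The new
    last column and last row supply the missing 1 to the other rows and columns; the corner stays 0
    because [ext_ASM] is 1 there. *)
Definition ext_low m l n (U : nat -> nat -> bool) (i j : nat) : bool :=
  if (i < n)%N && (j < n)%N then U i j || (i == j + m.+1)%N
  else if (i < n)%N then (i <= m)%N else (l <= j < n)%N.

Lemma alternating_eq n f g : (forall j, (j < n)%N -> f j = g j) -> alternating n f -> alternating n g.
Proof.
move=> fg [R [R0 Rn fE]]; exists R; split=> // j jn; by rewrite -fg // fE.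
Qed.

Lemma alternating_ext0 n f : alternating n f -> f n = 0 -> alternating n.+1 f.
Proof.
case=> R [R0 Rn fE] fn; exists (fun j => (n < j)%N || R j); split; rewrite ?ltnSn //.
move=> j; rewrite ltnS leq_eqVlt => /orP[/eqP ->|jn]; first by rewrite fn ltnSn Rn orbT.
by rewrite fE // ltnS leqNgt jn ltnNge (ltnW jn).
Qed.

Lemma alternating_last n f : (forall j, (j < n)%N -> f j = 0) -> f n = 1 -> alternating n.+1 f.
Proof.
move=> f0 f1; exists (fun j => n < j)%N; split=> // [|j]; first exact: ltnSn.
rewrite ltnS leq_eqVlt => /orP[/eqP ->|jn]; first by rewrite f1 ltnSn ltnn.
by rewrite f0 // ltnS leqNgt jn ltnNge (ltnW jn).
Qed.

Lemma sum_indicator (n x : nat) : (\sum_(j < n) (j == x :> nat) = (x < n))%N.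
Proof.
elim: n => [|n IH]; first by rewrite big_ord0.
by rewrite big_ord_recr /= IH; lia.
Qed.

Lemma sum_ltn (n x : nat) : (\sum_(j < n) (j < x) = minn n x)%N.
Proof.
elim: n => [|n IH]; first by rewrite big_ord0 min0n.
by rewrite big_ord_recr /= IH; lia.
Qed.

Lemma compatible_ext m l A U (n := (m + l).+1) :
  compatible n m A U -> vanish_below m n A U ->
  compatible n.+1 m.+1 (ext_ASM n A) (ext_low m l n U) /\
  vanish_below m.+1 n.+1 (ext_ASM n A) (ext_low m l n U).
Proof.
move=> [Ar Ac Ur Uc AU] Ab; split; last first.
  move=> i j iN ji; rewrite /ext_ASM /ext_low.
  have jn : (j < n)%N by lia.
  rewrite jn andbT; case: ifPn => [li|ni].
    have [|-> ->] := Ab i j li; first by lia.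
    by split=> //; lia.
  by rewrite andbT; split; rewrite /n in iN ni *; lia.
have ext_low_in i j : (i < n)%N -> (j < n)%N ->
    (ext_low m l n U i j = U i j + (i == j + m.+1) :> nat)%N.
  move=> li lj; rewrite /ext_low li lj /=; case: eqP => [E|_]; last by rewrite orbF addn0.
  by rewrite orbT; have [|_ ->] := Ab i j li; first by lia.
split.
- move=> i; rewrite ltnS leq_eqVlt => /orP[/eqP ->|li].
    apply: alternating_last => [j jn|]; rewrite /ext_ASM ltnn ?eqxx //=; lia.
  apply: alternating_ext0; last by rewrite /ext_ASM ltnn andbF (ltn_eqF li).
  by apply: alternating_eq (Ar i li) => j lj; rewrite /ext_ASM li lj.
- move=> j; rewrite ltnS leq_eqVlt => /orP[/eqP ->|lj].
    apply: alternating_last => [i li|]; rewrite /ext_ASM ltnn ?andbF ?eqxx //=; lia.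
  apply: alternating_ext0; last by rewrite /ext_ASM ltnn (gtn_eqF lj).
  by apply: alternating_eq (Ac j lj) => i li; rewrite /ext_ASM li lj.
- move=> i; rewrite big_ord_recr /= ltnS leq_eqVlt => /orP[/eqP ->|li].
    rewrite (eq_bigr (fun j : 'I_n => 1 - (j < l))%N); last first.
      by move=> j _; rewrite /ext_low ltnn ltn_ord andbT /=; lia.
    rewrite sumnB => [|j _]; last by case: (_ < _)%N.
    by rewrite sum1_card card_ord sum_ltn /ext_low ltnn /= /n; lia.
  rewrite (eq_bigr _ (fun (j : 'I_n) _ => ext_low_in i j li (ltn_ord j))) big_split /= Ur //.
  rewrite (eq_bigr (fun j : 'I_n => ((m < i) && (j == i - m.+1 :> nat)) : nat))%N; last first.
    by move=> j _; lia.
  rewrite /ext_low li ltnn /=; case: (ltnP m i) => mi /=.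
    by rewrite sum_indicator; lia.
  by rewrite big1 //; lia.
- move=> j; rewrite big_ord_recr /= ltnS leq_eqVlt => /orP[/eqP ->|lj].
    rewrite (eq_bigr (fun i : 'I_n => (i < m.+1) : nat)); last first.
      by move=> i _; rewrite /ext_low ltnn ltn_ord andbF.
    by rewrite sum_ltn /ext_low ltnn /= /n; lia.
  rewrite (eq_bigr _ (fun (i : 'I_n) _ => ext_low_in i j (ltn_ord i) lj)) big_split /= Uc //.
  by rewrite sum_indicator /ext_low ltnn lj /= /n; lia.
- move=> i j iN jN; rewrite /ext_ASM; case: ifP => [/andP[li lj]|ij].
    move=> A0; have := ext_low_in _ _ li lj; rewrite (AU i j li lj A0).
    case: (i =P (j + m.+1)%N) => [E|_].
      by have [|A00 _] := Ab i j li; [lia | rewrite A00 in A0].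
    by rewrite addn0; case: ext_low; case: eqP.
  case: (i =P j) => // E _; move: ij; rewrite /ext_low E; case: ltnP => //= _ _.
  by lia.
Qed.

Lemma count_neg_ext n A : count_neg n.+1 (ext_ASM n A) = count_neg n A.
Proof.
rewrite /count_neg big_ord_recr /= [X in (_ + X)%N]big1 ?addn0; last first.
  by move=> j _; rewrite /ext_ASM ltnn; case: eqP.
apply: eq_bigr => i _; rewrite big_ord_recr /=.
rewrite {2}/ext_ASM ltnn andbF; rewrite (ltn_eqF (ltn_ord i)) addn0.
by apply: eq_bigr => j _; rewrite /ext_ASM !ltn_ord.
Qed.

Lemma count_neg_card n A :
  count_neg n A = num_neg (\matrix_(i < n, j < n) A i j).
Proof.
rewrite /count_neg /num_neg pair_bigA /= -sum1_card big_mkcond /= [RHS]big_mkcond.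
by apply: eq_bigr => ij _; rewrite inE mxE; case: eqP.
Qed.

(** * The trimmed matrices *)

(* Prefix sums of row [i] of [F_n^k], [k = m.+1], [n = (m + l).+1], indices from
   0: in rotated coordinates the [-1] entries form an [l] by [m] rectangle.
   Trimming erases the last [r] of them on its upper right edge [j = i + m - 1],
   erases the [+1] entries [(i, i + m)] with [l - r <= i <= l], and puts a [+1]
   at [(l - r, n - 1)]. *)
Definition trim_row (m l r i j : nat) : bool :=
  (((m < i + j) && (i < j + m) &&
     if i == l - r then (j <= i + m) && odd (i + j + m)
     else if l - r < i <= l then (i + m < j + 2) || odd (i + j + m)
     else [|| m + l.*2 < i + j, i + m < j | odd (i + j + m)])
   || (i == l - r) && (m + l < j))%N.

(* Prefix sums of column [j] of the same matrix. *)
Definition trim_col (m l r i j : nat) : bool :=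
  (let past := [|| m + l.*2 < i + j, j + m < i | odd (i + j + m)] in
   if j == m + l then l - r < i
   else if m + l - r <= j then (j + 2 < i + m) && past
   else [&& m < i + j, j < i + m & past])%N.

Definition trimF m l r i j : int :=
  (trim_row m l r i j.+1)%:Z - (trim_row m l r i j)%:Z.

(* The sum of the planes below [F_n^k]: its upper left and lower right corners
   together with its [-1] entries. *)
Definition lowF (m l i j : nat) : bool :=
  [|| i + j < m, m + l.*2 < i + j |
   [&& i < j + m, j < i + m, m < i + j < m + l.*2 & odd (i + j + m)]]%N.

Lemma trimF_col m l r i j : (r <= l)%N -> (r <= m * l)%N ->
  (i < m + l + 1)%N -> (j < m + l + 1)%N ->
  trimF m l r i j = (trim_col m l r i.+1 j)%:Z - (trim_col m l r i j)%:Z.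
Proof.
move=> rl rml il jl.
(* A linear consequence of the product bound on [r]: if [m = 0] then [r = 0]. *)
have m0 : (0 < m)%N || (r == 0)%N by case: m rml {il jl} => //=; lia.
rewrite /trimF /trim_row /trim_col !(addnS, addSn) /=.
(* All parities reduce to this one; as a boolean tied to a half, it leaves only linear
   arithmetic. *)
have : odd (i + j + m) = ((i + j + m) != (i + j + m)./2.*2) by lia.
move: (odd (i + j + m)) => b Hb.
by repeat case: ifPn => ?; lia.
Qed.

Lemma lowF_sum m l i : (i < m + l + 1)%N ->
  (\sum_(j < m + l + 1) lowF m l i j = m)%N.
Proof.
move=> il.
pose a := (m - i + (i - m))%N; pose b := (minn (m + l.*2 - i) (i + m)).+1.
(* Row [i] of [F_n^k] is supported on [a <= j < b], where its signs alternate. *)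
pose S j := if (j <= a)%N then minn j (m - i)
  else if (j <= b)%N then (m - i + (j - a)./2)%N
  else (m - i + (b - a)./2 + (j - (m + l.*2 - i).+1))%N.
have [ab1 ab2] : (a <= b)%N /\ (b = a + (b - a)./2.*2 + 1)%N by rewrite /a /b; lia.
(* The branches of [S] count the upper left corner, then every second column of the support, then
   the lower right corner from column [m + l.*2 - i + 1]. Truncated subtraction makes an absent
   corner count 0. *)
have H j : (j <= m + l + 1)%N -> (\sum_(j' < j) lowF m l i j' = S j)%N.
  elim: j => [|j IH] lj; first by rewrite big_ord0 /S leq0n min0n.
  rewrite big_ord_recr /= IH; last lia.
  rewrite /S; have [ja|ja] := ltnP j a.
    have -> : lowF m l i j = (j < m - i)%N by rewrite /lowF /a in ja *; lia.
    by rewrite ltnW //; lia.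
  have [jb|jb] := ltnP j b; last first.
    have -> : lowF m l i j = (m + l.*2 - i < j)%N by rewrite /lowF /a /b in ja jb *; lia.
    have -> : (j <= a)%N = false by lia.
    case: ifPn => jb'; last by lia.
    have -> : (j - a = b - a)%N by lia.
    by rewrite /b in jb' *; lia.
  have -> : lowF m l i j = odd (j - a) by rewrite /lowF /a /b in ja jb *; lia.
  rewrite (ltnW jb); case: ifPn => ?; last by lia.
  have -> : j = a by lia.
  by rewrite /a; lia.
rewrite H // /S /a /b.
repeat case: ifPn => ?; lia.
Qed.

Lemma trimF_low m l r i j : (r <= l)%N -> (r <= m * l)%N ->
  (i < m + l + 1)%N -> (j < m + l + 1)%N ->
  trimF m l r i j != 0 -> lowF m l i j = (trimF m l r i j == -1).
Proof.
move=> rl rml il jl.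
have m0 : (0 < m)%N || (r == 0)%N by case: m rml {il jl} => //=; lia.
rewrite /trimF /trim_row /lowF !(addnS, addSn) /=.
have : odd (i + j + m) = ((i + j + m) != (i + j + m)./2.*2) by lia.
move: (odd (i + j + m)) => b Hb.
by repeat case: ifPn => ?; lia.
Qed.

Lemma trimF_neg m l r i j : (r <= l)%N -> (r <= m * l)%N ->
  (i < m + l + 1)%N -> (j < m + l + 1)%N ->
  (trimF m l r i j == -1) =
  [&& i < j + m, j < i + m, m < i + j < m + l.*2, odd (i + j + m)
    & ~~ ((l - r < i <= l) && (j + 1 == i + m))]%N.
Proof.
move=> rl rml il jl.
have m0 : (0 < m)%N || (r == 0)%N by case: m rml {il jl} => //=; lia.
rewrite /trimF /trim_row !(addnS, addSn) /=.
have : odd (i + j + m) = ((i + j + m) != (i + j + m)./2.*2) by lia.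
move: (odd (i + j + m)) => b Hb.
by repeat case: ifPn => ?; lia.
Qed.

Lemma lowFC m l i j : lowF m l i j = lowF m l j i.
Proof. by rewrite /lowF (addnC j i) andbCA. Qed.

(** Trimming preserves alternation: rows [l - r < i <= l] lose their final pair -1, +1, columns
    [m + l - r <= j < m + l] lose their initial pair +1, -1, and the +1 placed at [(l - r, n - 1)]
    repairs the remaining row and column. *)
Lemma compatible_trimF m l r (n := (m + l).+1) :
  (r <= l)%N -> (r <= m * l)%N -> compatible n m (trimF m l r) (lowF m l).
Proof.
move=> rl rml; have nE : n = (m + l + 1)%N by rewrite addn1.
have m0 : (0 < m)%N || (r == 0)%N by case: m rml {n nE} => //=; lia.
rewrite nE; split.
- move=> i il; exists (trim_row m l r i); split=> //; rewrite /trim_row.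
    by repeat case: ifPn => ?; lia.
  by repeat case: ifPn => ?; lia.
- move=> j jl; exists (trim_col m l r ^~ j); split; rewrite /trim_col.
  + by repeat case: ifPn => ?; lia.
  + by repeat case: ifPn => ?; lia.
  + by move=> i il; apply: trimF_col.
- by move=> i il; apply: lowF_sum.
- by move=> j jl; rewrite -[RHS](lowF_sum jl); apply: eq_bigr => i _; rewrite lowFC.
- by move=> i j il jl; apply: trimF_low.
Qed.

Lemma vanish_below_trimF m l r (n := (m + l).+1) :
  (r <= l)%N -> (r <= m * l)%N -> vanish_below m n (trimF m l r) (lowF m l).
Proof.
move=> rl rml i j; rewrite -[n]addn1 => il ji.
have Z : lowF m l i j = false by rewrite /lowF; lia.
split=> //; apply/eqP/negPn/negP => A0.
have jl : (j < m + l + 1)%N by lia.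
have := trimF_low rl rml il jl A0; rewrite Z trimF_neg //.
move: A0; rewrite /trimF /trim_row.
by repeat case: ifPn => ?; lia.
Qed.

Lemma num_neg_trimF m l r (n := (m + l).+1) :
  (r <= l)%N -> (r <= m * l)%N ->
  num_neg (\matrix_(i < n, j < n) trimF m l r i j) = (m * l - r)%N.
Proof.
move=> rl rml; set t := (m * l - r)%N.
have lt0 (q : 'I_t) : (0 < l)%N.
  by case: q => q; rewrite /t; case: l rl rml {n t} => //; rewrite muln0.
have qm (q : 'I_t) : (q %/ l < m)%N.
  rewrite ltn_divLR; first by apply: leq_trans (ltn_ord q) _; rewrite leq_subr.
  exact: lt0.
have ql (q : 'I_t) : (q %% l < l)%N by rewrite ltn_mod lt0.
(* The [-1] entries, listed along the rotated rectangle with [r] cells missing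
   in its last row. *)
pose f (q : 'I_t) : 'I_n * 'I_n :=
  (inord (m + q %% l - q %/ l), inord (q %% l + q %/ l).+1).
have f1 q : (f q).1 = (m + q %% l - q %/ l)%N :> nat.
  by rewrite /f /= inordK // ltnS; have := ql q; move: (q %% l)%N (q %/ l)%N; lia.
have f2 q : (f q).2 = (q %% l + q %/ l).+1 :> nat.
  by rewrite /f /= inordK // ltnS; have := ql q; have := qm q; move: (q %% l)%N (q %/ l)%N; lia.
have fi : injective f.
  move=> x y exy; apply: val_inj; rewrite /= (divn_eq x l) (divn_eq y l).
  have := f1 x; have := f2 x; rewrite exy f1 f2.
  move: (x %/ l)%N (y %/ l)%N (x %% l)%N (y %% l)%N (qm x) (qm y) => a b c d am bm e1 e2.
  by have [-> ->] : a = b /\ c = d by lia.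
rewrite /num_neg -[RHS]card_ord -(card_imset predT fi); apply: eq_card => -[i j].
rewrite !inE mxE /= trimF_neg //; try by rewrite addn1.
apply/idP/imsetP => [H|[q _ e]].
  (* This inverts [f] by solving [i = m + a - b], [j = a + b + 1]; the trimmed edge [j + 1 = i + m]
     is the row [b = m - 1]. *)
  pose a := ((i + j - m)./2)%N; pose b := ((m + j - i)./2)%N.
  have ab : (i + b = m + a /\ j = (a + b).+1 :> nat)%N by rewrite /a /b; lia.
  have am : (a < l)%N by rewrite /a; lia.
  have bm : (b < m)%N by rewrite /b; lia.
  have qt : (b * l + a < t)%N.
    have [b1|b1] : (b.+1 = m \/ b.+2 <= m)%N by lia.
      have : (a < l - r)%N by lia.
      rewrite /t -b1 mulSn; lia.
    have : (b.+2 * l <= m * l)%N by rewrite leq_mul2r b1 orbT.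
    by rewrite /t !mulSn; lia.
  exists (Ordinal qt) => //; rewrite [f _]surjective_pairing; congr pair; apply: ord_inj.
    by rewrite f1 /= modnMDl modn_small // divnMDl ?divn_small //; lia.
  by rewrite f2 /= modnMDl modn_small // divnMDl ?divn_small //; lia.
have ei : i = (m + q %% l - q %/ l)%N :> nat by rewrite -f1 -e.
have ej : j = (q %% l + q %/ l).+1 :> nat by rewrite -f2 -e.
have := divn_eq q l; have := ltn_ord q; rewrite {2}/t.
rewrite ei ej; move: (q %% l)%N (q %/ l)%N (ql q) (qm q) => a b al bm qt qE.
have : ~~ ((l - r <= a) && (b.+1 == m))%N.
  apply/negP => /andP[la /eqP bE]; move: qt; rewrite qE -bE mulSn; lia.
lia.
Qed.

(** * All values of t *)

Lemma compatible_exists m l t (n := (m + l).+1) : (t <= m * l)%N ->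
  exists A U, [/\ compatible n m A U, vanish_below m n A U & count_neg n A = t].
Proof.
rewrite {}/n; elim: m t => [|m IH] t tm.
  exists (trimF 0 l 0), (lowF 0 l); split; [exact: compatible_trimF|exact: vanish_below_trimF|].
  by rewrite count_neg_card num_neg_trimF //; lia.
have [tl|tl] := leqP t (m * l).
  have [A [U [C B <-]]] := IH t tl.
  have [C' B'] := compatible_ext C B.
  by exists (ext_ASM (m + l).+1 A), (ext_low m l (m + l).+1 U); split=> //; apply: count_neg_ext.
have rl : (m.+1 * l - t <= l)%N by rewrite mulSn; lia.
have rml : (m.+1 * l - t <= m.+1 * l)%N by apply: leq_subr.
exists (trimF m.+1 l (m.+1 * l - t)), (lowF m.+1 l); split.
- exact: compatible_trimF.
- exact: vanish_below_trimF.
by rewrite count_neg_card num_neg_trimF // subKn.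
Qed.

Unset Implicit Arguments.

(* Planes are indexed by s : 'I_n, with s.+1 the paper's 1-based index;
   the plane with s.+1 = k is A_k, the others are permutation matrices. *)
Theorem mainTheorem13 (n k t : nat) :
  (1 <= k)%N -> (k <= n)%N -> (t <= (k - 1) * (n - k))%N ->
  exists (A : 'M[int]_n) (P : 'I_n -> 'M[int]_n),
    [/\ is_ASM A, num_neg A = t,
        (forall s : 'I_n, s.+1 != k -> is_perm_mx (P s)) &
        is_ASHM (fun s : 'I_n => if s.+1 == k then A else P s)].
Proof.
case: k => // m _ mn; rewrite subSS subn0.
have [l ->] : exists l, n = (m + l).+1 by exists (n - m.+1)%N; lia.
rewrite subSS addKn => /compatible_exists[A [U [C _ At]]].
have [P [Pperm H]] := compatible_ASHM C.
exists (\matrix_(i, j) A i j), P; split=> //; first last.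
  by rewrite -count_neg_card.
(* That [A] is an ASM is read off from plane [m] of the ASHM. *)
case: H => _ [Hr Hc]; have mlt : (m < (m + l).+1)%N by rewrite ltnS leq_addr.
by split=> i; [have := Hr (Ordinal mlt) i | have := Hc (Ordinal mlt) i]; rewrite /= eqxx.
Qed.
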